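(* Let $k\ge 2$, let $\Phi=\{\phi_1,\ldots,\phi_k\}$ be an injective IFS and let $\boldsymbol{a}=(a_1,\ldots,a_{k-1})\in\Omega_k$. Then $$\dim_H\left\{\delta\in\mathbb{R}\colon f_{\Phi,\boldsymbol{a}+\delta}\text{ is not asymptotically periodic}\right\}=0,$$ where $\dim_H$ denotes Hausdorff dimension.
   Context: $\Omega_k=\{(a_1,\ldots,a_{k-1})\in\mathbb{R}^{k-1}\colon a_1<\cdots<a_{k-1}\}$ for $k\ge2$. An IFS is a finite (indexed) collection $\Phi=\{\phi_i\colon\mathbb{R}\to\mathbb{R}\}_{i=1}^k$ of Lipschitz contractions (each $\phi_i$ is Lipschitz with constant $<1$). It is injective if every $\phi_i$ is an injective function. Given an IFS $\Phi$ and $\boldsymbol{a}\in\Omega_k$, the map $f_{\Phi,\boldsymbol{a}}\colon\mathbb{R}\to\mathbb{R}$ is defined by $f_{\Phi,\boldsymbol{a}}(x)=\phi_1(x)$ for $x\in(-\infty,a_1)$, $f_{\Phi,\boldsymbol{a}}(x)=\phi_i(x)$ for $x\in[a_{i-1},a_i)$ and $i\in\{2,\ldots,k-1\}$, and $f_{\Phi,\boldsymbol{a}}(x)=\phi_k(x)$ for $x\in[a_{k-1},+\infty)$. For $\delta\in\mathbb{R}$, $\boldsymbol{a}+\delta=(a_1+\delta,\ldots,a_{k-1}+\delta)\in\Omega_k$. For a map $f\colon\mathbb{R}\to\mathbb{R}$ and $x\in\mathbb{R}$, the $\omega$-limit set $\omega(f,x)$ is the set of accumulation points of the forward orbit (the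 sequence $(f^n(x))_{n\ge0}$) of $x$ under $f$. The map $f$ is asymptotically periodic if it has at most a finite number of periodic orbits and, for every $x\in\mathbb{R}$, $\omega(f,x)$ is a periodic orbit of $f$. *)

(* Defs.v *)
From HB Require Import structures.
From mathcomp Require Import all_boot all_order all_algebra.
From mathcomp Require Import all_classical all_reals all_analysis.
Set Implicit Arguments.
Unset Strict Implicit.
Unset Printing Implicit Defensive.
Import Order.TTheory GRing.Theory Num.Theory.
Import numFieldNormedType.Exports.
Local Open Scope classical_set_scope.
Local Open Scope ring_scope.

Section HausdorffDimension.
Context {R : realType}.
Implicit Types (A U : set R) (s d : R).

(* -oo on the empty set; [diam_pow] below treats that case separately. *)
Definition diam U : \bar R :=
  ereal_sup [set `|p.1 - p.2|%:E | p in U `*` U].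

(* |U|^s, with the convention |set0|^s = 0 for every s >= 0, including s = 0
   (on a singleton, |U|^0 = 1). *)
Definition diam_pow s U : \bar R :=
  if U == set0 then 0%E else (diam U `^ s)%E.

Definition hausdorff_premeasure s d A : \bar R :=
  ereal_inf [set (\sum_(0 <= n <oo) diam_pow s (U n))%E
            | U in [set U : (set R)^nat |
                     A `<=` \bigcup_n U n /\
                     forall n, (diam (U n) <= d%:E)%E]].

Definition hausdorff_measure s A : \bar R :=
  ereal_sup [set hausdorff_premeasure s d A | d in [set d : R | 0 < d]].

Definition hausdorff_dim A : \bar R :=
  ereal_inf [set s%:E | s in [set s : R | 0 <= s /\ hausdorff_measure s A = 0%E]].

End HausdorffDimension.

Section Dynamics.
Context {R : realType}.
Implicit Types (f : R -> R) (x : R).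

Definition forward_orbit f x : set R := [set iter n f x | n in [set: nat]].

Definition periodic_orbit f (O : set R) : Prop :=
  exists x, (exists2 n, (0 < n)%N & iter n f x = x) /\ O = forward_orbit f x.

(* Accumulation points of the sequence (iter n f x)_n, not of its range. *)
Definition omega_limit f x : set R := cluster (iter n f x @[n --> \oo]).

Definition asymptotically_periodic f : Prop :=
  finite_set [set O | periodic_orbit f O] /\
  forall x, periodic_orbit f (omega_limit f x).

End Dynamics.

Section IteratedFunctionSystems.
Context {R : realType} {k : nat}.
Implicit Types (phi : 'I_k -> R -> R) (a : 'I_k.-1 -> R) (x : R).

Definition is_IFS phi : Prop :=
  forall i, exists q : R, 0 <= q < 1 /\ q.-lipschitz (phi i).

Definition injective_IFS phi : Prop :=
  is_IFS phi /\ forall i, injective (phi i).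

(* Indices start at 0: the parameter a_(j+1) of the text is [a j], and its map
   phi_(i+1) is [phi i]. *)
Definition Omega : set ('I_k.-1 -> R) :=
  [set a | forall i j : 'I_k.-1, (i < j)%N -> a i < a j].

Definition translate_param a (delta : R) : 'I_k.-1 -> R := fun j => a j + delta.

(* x lies in [a (i-1), a i), where the left (resp. right) endpoint is -oo
   (resp. +oo) when i is the first (resp. last) index, as then no j satisfies
   j.+1 == i (resp. j == i). *)
Definition in_piece a (i : 'I_k) x : bool :=
  [forall j : 'I_k.-1, (j.+1 == i :> nat) ==> (a j <= x)] &&
  [forall j : 'I_k.-1, (j == i :> nat) ==> (x < a j)].

(* The pieces partition the line when a is in Omega and k > 0 (see
   [pw_mapE] and [in_piece_ex]), so that the default value is not used. *)
Definition pw_map phi a x : R :=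
  if [pick i | in_piece a i x] is Some i then phi i x else x.

Lemma in_piece_uniq a i i' x : Omega a ->
  in_piece a i x -> in_piece a i' x -> i = i'.
Proof.
move=> Oa; wlog lt_ii' : i i' / (i < i')%N.
  move=> H Hi Hi'; case: (ltngtP i i') => [lt|lt|/val_inj //].
  - exact: H.
  - by apply/esym; exact: H.
move=> /andP[_ /forallP Hu] /andP[/forallP Hl _].
have i'0 : (0 < i')%N by exact: leq_ltn_trans lt_ii'.
have ii' : (i <= i'.-1)%N by rewrite -ltnS prednK.
have i'k : (i'.-1 < k.-1)%N by rewrite ltn_predRL prednK.
have ik : (i < k.-1)%N by exact: leq_ltn_trans i'k.
have := Hu (Ordinal ik); rewrite eqxx /= => x_lt.
have := Hl (Ordinal i'k); rewrite /= prednK// eqxx /= => le_x.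
have := le_lt_trans le_x x_lt.
move: ii'; rewrite leq_eqVlt => /orP[/eqP e|lt].
  by rewrite (_ : Ordinal i'k = Ordinal ik) ?ltxx//; apply/val_inj.
by move/(lt_trans (Oa (Ordinal ik) (Ordinal i'k) lt)); rewrite ltxx.
Qed.

Lemma in_piece_ex a x : (0 < k)%N -> exists i, in_piece a i x.
Proof.
move=> k0.
pose P m := [exists j : 'I_k.-1, (j == m :> nat) && (x < a j)] || (m == k.-1).
have exP : exists m, P m by exists k.-1; rewrite /P eqxx orbT.
case: (ex_minnP exP) => m Pm minm.
have mk : (m < k)%N.
  by rewrite -(prednK k0) ltnS minm// /P eqxx orbT.
exists (Ordinal mk); apply/andP; split; apply/forallP => j; apply/implyP => /= /eqP e.
- rewrite leNgt; apply/negP => xa.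
  have : P j by apply/orP; left; apply/existsP; exists j; rewrite eqxx.
  by move/minm; rewrite -e ltnn.
- case/orP: Pm => [/existsP[j' /andP[/eqP e' xa]]|/eqP mE].
    by rewrite (_ : j = j')//; apply/val_inj; rewrite /= e e'.
  by have := ltn_ord j; rewrite e mE ltnn.
Qed.

Lemma pw_mapE phi a i x : Omega a -> in_piece a i x -> pw_map phi a x = phi i x.
Proof.
move=> Oa Hi; rewrite /pw_map; case: pickP => [i' Hi'|/(_ i)]; last by rewrite Hi.
by rewrite (in_piece_uniq Oa Hi Hi').
Qed.

End IteratedFunctionSystems.

(* Main.v *)
Require Import Defs.
From mathcomp Require Import all_boot all_order all_algebra.
From mathcomp Require Import all_classical all_reals all_analysis.
From mathcomp Require Import lra zify.
Set Implicit Arguments.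
Unset Strict Implicit.
Unset Printing Implicit Defensive.
Import Order.TTheory GRing.Theory Num.Theory.
Import numFieldNormedType.Exports.
Local Open Scope classical_set_scope.
Local Open Scope ring_scope.

(** Call a word of length n realised by (x, delta) if it codes the first n steps
    of the orbit of x under the map with breakpoints a + delta.  If, for some n,
    no breakpoint is within q^n M of the images of the interval [-M, M] under
    the realised words of length n, then the first n letters of an itinerary
    determine the next one; the shift on the finitely many realised words is
    then deterministic, and contraction yields asymptotic periodicity.  Hence
    the exceptional delta lie, for every n, within q^n M of finitely many
    points, one for each breakpoint and each realised word.

    It remains to show that the number of words realised for delta in a small
    interval grows more slowly than any exponential.  Injective contractions
    are monotone, and a difference of parameters is preserved while a
    difference of positions is contracted; comparing the two shows that at most
    4(N+1) words of length N are realised near a given (x0, d0).  By compactness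
    this holds uniformly at some scale e, and once the images of [-M, M] are
    smaller than e, each block of N further letters multiplies the number of
    words by at most 4(N+1). *)

(** * Finite families, limit sets and elementary estimates *)

(** Applied to narrowness along an orbit: one switching time encodes the truth values at all times
    below [N], whence a count linear in [N]. *)
Lemma nondecreasing_predE (P : pred nat) (N : nat) :
  (forall t, P t -> P t.+1) ->
  exists2 tau, (tau <= N)%N & forall t, (t < N)%N -> P t = ~~ (t < tau)%N.
Proof.
move=> PS; elim: N => [|N [tau tauN tauP]]; first by exists 0%N.
have [PN|nPN] := boolP (P N).
  exists tau; first exact: leqW.
  move=> t; rewrite ltnS leq_eqVlt => /predU1P[->|]; last exact: tauP.
  by rewrite PN -leqNgt tauN.
exists N.+1 => // t tN; rewrite tN /=; apply/negbTE.
apply: contra nPN => Pt; rewrite -(subnKC (ltnSE tN)).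
by elim: (N - t)%N => [|m IH]; rewrite ?addn0// addnS; exact: PS.
Qed.

(** Zero values are skipped: a breakpoint that meets the reference orbit exactly is treated
    separately. *)
Lemma finite_gap (R : realType) (T : finType) (g : T -> R) :
  exists2 r, 0 < r & forall x, g x != 0 -> r <= `|g x|.
Proof.
have [r r0 rP] : exists2 r, 0 < r &
    forall x, x \in enum T -> g x != 0 -> r <= `|g x|.
  elim: (enum T) => [|y s [r r0 rP]]; first by exists 1.
  have [gy|gy] := eqVneq (g y) 0.
    exists r => // x; rewrite inE => /predU1P[->|]; last exact: rP.
    by rewrite gy eqxx.
  exists (Num.min r `|g y|); first by rewrite lt_min r0 normr_gt0.
  move=> x; rewrite inE => /predU1P[-> _|xs gx]; first by rewrite ge_min lexx orbT.
  by rewrite ge_min rP.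
by exists r => // x; apply: rP; rewrite mem_enum.
Qed.

Lemma lipschitz_cts (R : realType) (q : R) (g : R -> R) : 0 < q ->
  (forall x y, `|g x - g y| <= q * `|x - y|) -> continuous g.
Proof.
move=> q0 glip x; apply/cvgrPdist_lt => e e0.
have : nbhs x (ball x (e / q)) by apply: nbhsx_ballx; exact: divr_gt0.
apply: filterS => y; rewrite /ball /= ltr_pdivlMr// mulrC.
exact/le_lt_trans/glip.
Qed.

Lemma geometric_small (R : realType) (q C e : R) : 0 < q < 1 -> 0 < e ->
  exists n, forall t, (n <= t)%N -> q ^+ t * C < e.
Proof.
move=> /andP[q0 q1] e0.
have /cvgrPdist_lt /(_ e e0) : geometric C q n @[n --> \oo] --> 0.
  by apply: cvg_geometric; rewrite gtr0_norm.
move=> [n _ nP]; exists n => t nt; have := nP t nt.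
by rewrite sub0r normrN /= mulrC; apply: le_lt_trans; exact: ler_norm.
Qed.

Lemma iter_period (T : Type) (f : T -> T) (p m : nat) (z : T) :
  iter p f z = z -> iter (m * p) f z = z.
Proof. by move=> pz; rewrite iterM iter_fix. Qed.

(** The delayed orbit of [x] approaches the orbit of [z] geometrically; a point off this finite
    orbit keeps a positive distance from it, so it cannot be an accumulation point. *)
Lemma omega_limit_shadow (R : realType) (f : R -> R) (x z q C : R) (T p : nat) :
  0 < q < 1 -> (0 < p)%N -> iter p f z = z ->
  (forall t, `|iter t f z - iter (t + T) f x| <= q ^+ t * C) ->
  omega_limit f x = forward_orbit f z.
Proof.
move=> q01 p0 pz shadow; apply/seteqP; split => [y|y [m _ <-]].
  move=> cly; apply: contrapT => Oy.
  have [r r0 rP] := finite_gap (fun i : 'I_p => y - iter i f z).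
  have {}rP t : r <= `|y - iter t f z|.
    rewrite (divn_eq t p) addnC iterD iter_period//.
    apply: (rP (Ordinal (ltn_pmod t p0))); rewrite subr_eq0 /=.
    by apply/eqP => e; apply: Oy; exists (t %% p)%N.
  have r20 : 0 < r / 2 by rewrite divr_gt0.
  have [n nP] := geometric_small C q01 r20.
  pose tail := [set iter t f x | t in [set t | (n + T <= t)%N]].
  have := cly tail (ball y (r / 2)).
  case.
  - by exists (n + T)%N => // t /= nt; exists t.
  - exact: nbhsx_ballx.
  move=> _ [[t /= nt <-]]; rewrite /ball /= => yt.
  have tT : (T <= t)%N by lia.
  have := shadow (t - T)%N; rewrite subnK// => sh.
  have := nP (t - T)%N; rewrite leq_subRL// addnC => /(_ nt) small.
  have := rP (t - T)%N; have := ler_distD (iter t f x) y (iter (t - T) f z).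
  by rewrite (distrC (iter t f x)); lra.
move=> A B [n1 _ n1P] /nbhs_ballP[e /= e0 eB].
have [n nP] := geometric_small C q01 e0.
pose t := (m + (n + n1) * p)%N.
have tn : (n + n1 <= t)%N by rewrite /t; nia.
have zt : iter t f z = iter m f z by rewrite iterD iter_period.
exists (iter (t + T) f x); split; first by apply: n1P => /=; lia.
apply: eB; rewrite /ball /= -zt; apply: le_lt_trans (shadow t) _.
by apply: nP; lia.
Qed.

(** Split [r ^+ N] into two factors [t ^+ N], with [t] the square root of [r]. One absorbs [N.+1],
    since 1 + t + ... + t^N has N + 1 terms, each at least t^N; the other tends to 0. *)
Lemma linear_geometric_small (R : realType) (r e : R) : 0 < r < 1 -> 0 < e ->
  exists2 N, (0 < N)%N & N.+1%:R * r ^+ N < e.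
Proof.
move=> /andP[r0 r1] e0; pose t := Num.sqrt r.
have t0 : 0 < t by rewrite sqrtr_gt0.
have t1 : t < 1 by rewrite -sqrtr1 ltr_sqrt.
have tsum N : N.+1%:R * t ^+ N * (1 - t) <= 1 - t ^+ N.+1.
  elim: N => [|N IH]; first by rewrite !mul1r expr1.
  have tN : 0 <= t ^+ N.+1 by rewrite exprn_ge0// ltW.
  rewrite -natr1 mulrDl mul1r mulrDl.
  have -> : N.+1%:R * t ^+ N.+1 * (1 - t) = t * (N.+1%:R * t ^+ N * (1 - t)).
    by rewrite exprS !mulrA (mulrC _ t).
  have : t * (N.+1%:R * t ^+ N * (1 - t)) <= t * (1 - t ^+ N.+1).
    by rewrite ler_pM2l.
  have : t ^+ N.+1 * (1 - t) <= 1 - t.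
    by rewrite ler_piMl ?subr_ge0 ?exprn_ile1// ltW.
  rewrite (exprS _ N.+1); lra.
have et : 0 < e * (1 - t) by rewrite mulr_gt0// subr_gt0.
have [n nP] := @geometric_small R t 1 _ (introT andP (conj t0 t1)) et.
exists n.+1 => //; have /nP : (n <= n.+1)%N by [].
rewrite mulr1 => small.
have tt : r ^+ n.+1 = t ^+ n.+1 * t ^+ n.+1.
  by rewrite -exprMn -expr2 sqr_sqrtr// ltW.
have t1' : 0 < 1 - t by rewrite subr_gt0.
rewrite -(ltr_pM2r t1') tt mulrA mulrAC.
have tn0 : 0 < t ^+ n.+1 by rewrite exprn_gt0.
apply: le_lt_trans small.
rewrite ler_piMl ?(ltW tn0)//; apply: le_trans (tsum _) _.
by rewrite gerBl exprn_ge0// ltW.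
Qed.

Lemma grid_cover (R : realType) (B e : R) : 0 < e -> exists E : seq R,
  forall d, `|d| <= B -> exists2 c, c \in E & `|c| <= B /\ `|d - c| < e.
Proof.
move=> e0.
exists [seq - B + i%:R * (e / 2) | i <- iota 0 (Num.truncn ((B + B) / (e / 2))).+1].
move=> d; rewrite ler_norml => /andP[Bd dB].
have e20 : 0 < e / 2 by rewrite divr_gt0.
have x0 : 0 <= (d + B) / (e / 2) by rewrite divr_ge0 ?(ltW e20)//; lra.
have /andP[] := truncn_itv x0.
set i := Num.truncn _; rewrite ler_pdivlMr// ltr_pdivrMr// => h1 h2.
(* Rounding down keeps the centre between [- B] and [d], in the range where the word count
   applies. *)
exists (- B + i%:R * (e / 2)).
  apply/mapP; exists i => //; rewrite mem_iota /= add0n ltnS.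
  by apply: le_truncn; rewrite ler_pM2r ?invr_gt0//; lra.
have i0 : 0 <= i%:R * (e / 2) by rewrite mulr_ge0// ltW.
move: h2; rewrite -natr1 mulrDl mul1r => h2.
by split; [rewrite ler_norml|rewrite ltr_norml]; apply/andP; split; lra.
Qed.

(** * Hausdorff dimension zero from finite covers by balls *)

Section HausdorffDimensionZero.
Context {R : realType}.
Implicit Types (A U : set R) (s d : R).

Lemma diam_pow_ge0 s U : (0 <= diam_pow s U)%E.
Proof. by rewrite /diam_pow; case: ifP => // _; exact: poweR_ge0. Qed.

Lemma hausdorff_premeasure_ge0 s d A : (0 <= hausdorff_premeasure s d A)%E.
Proof.
apply: le_ereal_inf_tmp => _ [U _ <-]; apply: nneseries_ge0 => n _ _.
exact: diam_pow_ge0.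
Qed.

Lemma diam_ball (c r : R) : (diam [set x : R | (`|x - c| <= r)%R] <= (2 * r)%:E)%E.
Proof.
apply: ge_ereal_sup => _ [[x y] [/= xc yc] <-]; rewrite lee_fin.
by have := ler_distD c x y; rewrite (distrC c y); lra.
Qed.

Lemma diam_pow_ball s (c r : R) : 0 <= s -> 0 <= r ->
  (diam_pow s [set x : R | (`|x - c| <= r)%R] <= ((2 * r) `^ s)%:E)%E.
Proof.
move=> s0 r0; have cc : `|c - c| <= r by rewrite subrr normr0.
rewrite /diam_pow ifF; last first.
  by apply/negP => /eqP e0; have : [set x : R | `|x - c| <= r] c by []; rewrite e0.
rewrite -poweR_EFin; apply: gt0_ler_poweR => //; last exact: diam_ball.
  rewrite in_itv /= leey andbT; apply: ereal_sup_ubound.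
  by exists (c, c) => //=; rewrite subrr normr0.
by rewrite in_itv /= leey andbT lee_fin mulr_ge0.
Qed.

Lemma hausdorff_premeasure_cover s d A (L : seq R) (r : R) : 0 <= s -> 0 <= r ->
  2 * r <= d -> (forall x, A x -> exists2 c, c \in L & `|x - c| <= r) ->
  (hausdorff_premeasure s d A <= ((size L)%:R * (2 * r) `^ s)%:E)%E.
Proof.
move=> s0 r0 rd AL.
(* Padding by empty sets costs nothing, since [diam_pow] vanishes on [set0]. *)
pose U n : set R := [set x | (n < size L)%N /\ `|x - nth 0 L n| <= r].
have UE n : (n < size L)%N -> U n = [set x | `|x - nth 0 L n| <= r].
  by move=> nL; apply/seteqP; split => x //= [].
have U0 n : (size L <= n)%N -> U n = set0.
  by move=> nL; apply/seteqP; split => x //= []; rewrite ltnNge nL.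
apply: (@le_trans _ _ (\sum_(0 <= n <oo) diam_pow s (U n))%E).
  apply: ereal_inf_lbound; exists U => //; split.
    move=> x /AL[c cL xc]; exists (index c L) => //=; rewrite /U /= index_mem.
    by rewrite nth_index.
  move=> n; case: (ltnP n (size L)) => nL.
    by rewrite UE//; apply: le_trans (diam_ball _ _) _; rewrite lee_fin.
  by rewrite U0//; apply: ge_ereal_sup => _ [[x y] [[]]].
rewrite (nneseries_split 0 (size L)); last by move=> n _; exact: diam_pow_ge0.
have -> : (\sum_(0 + size L <= n <oo) diam_pow s (U n) = 0)%E.
  by apply: eseries0 => n; rewrite add0n => nL _; rewrite U0// /diam_pow eqxx.
rewrite add0n adde0.
apply: (@le_trans _ _ (\sum_(0 <= n < size L) ((2 * r) `^ s)%:E)%E).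
  rewrite big_nat [leRHS]big_nat; apply: lee_sum => n /andP[_ nL].
  by rewrite UE//; exact: diam_pow_ball.
by rewrite sumEFin lee_fin sumr_const_nat subn0 [leRHS]mulr_natl.
Qed.

Lemma hausdorff_dim_eq0 A :
  (forall s d e : R, 0 < s -> 0 < d -> 0 < e -> exists L (r : R),
    [/\ 0 <= r, 2 * r <= d, (size L)%:R * (2 * r) `^ s <= e &
      forall x, A x -> exists2 c, c \in L & `|x - c| <= r]) ->
  hausdorff_dim A = 0%E.
Proof.
move=> Acov.
have meas0 s : 0 < s -> hausdorff_measure s A = 0%E.
  move=> s0; apply/eqP; rewrite eq_le; apply/andP; split.
    apply: ge_ereal_sup => _ [d /= d0 <-]; apply/lee_addgt0Pr => e e0.
    have [L [r [r0 rd re AL]]] := Acov s d e s0 d0 e0.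
    rewrite add0e; apply: le_trans (hausdorff_premeasure_cover (ltW s0) r0 rd AL) _.
    by rewrite lee_fin.
  apply: le_trans (hausdorff_premeasure_ge0 s 1 A) _.
  by apply: ereal_sup_ubound; exists 1 => /=.
apply/eqP; rewrite eq_le; apply/andP; split; last first.
  by apply: le_ereal_inf_tmp => _ [s [s0 _] <-]; rewrite lee_fin.
apply/lee_addgt0Pr => e e0; rewrite add0e.
by apply: ereal_inf_lbound; exists e => //; split; [exact: ltW|exact: meas0].
Qed.

End HausdorffDimensionZero.

(** * Coding of orbits by words *)

Section Itineraries.
Context {R : realType} {k : nat} (phi : 'I_k -> R -> R) (i0 : 'I_k).
Implicit Types (b : 'I_k.-1 -> R) (x y z : R) (w u : seq 'I_k).

(* The piece of any x such that s j = (b j <= x) for every j; i0 is a junk value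
   for the s that no x realises. *)
Definition piece_of (s : 'I_k.-1 -> bool) : 'I_k :=
  odflt i0 [pick i : 'I_k | [forall j : 'I_k.-1, (j.+1 == i :> nat) ==> s j] &&
                            [forall j : 'I_k.-1, (j == i :> nat) ==> ~~ s j]].

Definition piece b x : 'I_k := piece_of (fun j => b j <= x).

Lemma eq_piece_of s s' : s =1 s' -> piece_of s = piece_of s'.
Proof. by move=> /funext ->. Qed.

Lemma in_piece_piece b x : in_piece b (piece b x) x.
Proof.
rewrite /piece /piece_of; case: pickP => [i|nP] /=.
  move=> /andP[h1 h2]; apply/andP; split=> //.
  by apply/forallP => j; move/forallP: h2 => /(_ j); rewrite -ltNge.
have [i] := in_piece_ex b x (leq_ltn_trans (leq0n i0) (ltn_ord i0)).
move=> /andP[h1 h2]; have /negP[] := negbT (nP i); rewrite h1 /=.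
by apply/forallP => j; move/forallP: h2 => /(_ j); rewrite -ltNge.
Qed.

Lemma pw_map_piece b x : Omega b -> pw_map phi b x = phi (piece b x) x.
Proof. by move=> Ob; apply: pw_mapE => //; exact: in_piece_piece. Qed.

Definition wcomp w x : R := foldl (fun y i => phi i y) x w.

Lemma wcomp_rcons w i x : wcomp (rcons w i) x = phi i (wcomp w x).
Proof. by rewrite /wcomp foldl_rcons. Qed.

Definition itinerary b n x : seq 'I_k :=
  mkseq (fun t => piece b (iter t (pw_map phi b) x)) n.

Lemma size_itinerary b n x : size (itinerary b n x) = n.
Proof. exact: size_mkseq. Qed.

Lemma itineraryS b n x : itinerary b n.+1 x =
  rcons (itinerary b n x) (piece b (iter n (pw_map phi b) x)).
Proof. exact: mkseqS. Qed.

Lemma itineraryD b m n x : itinerary b (m + n) x =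
  itinerary b m x ++ itinerary b n (iter m (pw_map phi b) x).
Proof.
elim: n => [|n IH]; first by rewrite addn0 cats0.
by rewrite addnS !itineraryS IH rcons_cat -iterD addnC.
Qed.

Lemma wcomp_itinerary b n x : Omega b ->
  wcomp (itinerary b n x) x = iter n (pw_map phi b) x.
Proof.
move=> Ob; elim: n => [//|n IH].
by rewrite itineraryS wcomp_rcons IH iterS pw_map_piece.
Qed.

End Itineraries.

(** * Comparison of positions and parameters along a common word *)

Section PiecewiseContractions.
Context {R : realType} {k : nat} (phi : 'I_k -> R -> R) (i0 : 'I_k) (q : R).
Hypothesis q01 : 0 < q < 1.
Hypothesis phi_lip : forall i x y, `|phi i x - phi i y| <= q * `|x - y|.
Variable dec : 'I_k -> bool.
Hypothesis phi_mono : forall i x y, x < y ->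
  (phi i x != phi i y) && ((phi i x < phi i y) == ~~ dec i).
Variable a : 'I_k.-1 -> R.
Hypothesis Oa : Omega a.
Implicit Types (x y z d : R) (w u : seq 'I_k).
Local Notation wcomp := (wcomp phi).
Local Notation f d := (pw_map phi (translate_param a d)).
Local Notation itin d := (itinerary phi i0 (translate_param a d)).

Let q0 : 0 < q. Proof. by case/andP: q01. Qed.
Let q1 : q < 1. Proof. by case/andP: q01. Qed.

Lemma Omega_translate d : Omega (translate_param a d).
Proof. by move=> i j ij; rewrite /translate_param ltrD2r; exact: Oa. Qed.

Lemma wcomp_lip w x y : `|wcomp w x - wcomp w y| <= q ^+ size w * `|x - y|.
Proof.
elim/last_ind: w => [|w i IH]; first by rewrite mul1r.
rewrite !wcomp_rcons size_rcons exprS -mulrA.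
by apply: le_trans (phi_lip _ _ _) _; rewrite ler_pM2l.
Qed.

Definition reverses w : bool := foldl (fun e i => e (+) dec i) false w.

Lemma wcomp_mono w x y : x != y ->
  (wcomp w x != wcomp w y) && ((wcomp w x < wcomp w y) == (x < y) (+) reverses w).
Proof.
move=> xy; elim/last_ind: w => [|w i]; first by rewrite xy addbF eqxx.
rewrite !wcomp_rcons /reverses foldl_rcons -/(reverses w) => /andP[].
set u := wcomp w x; set v := wcomp w y => uv /eqP e.
rewrite addbA -{}e; case: (ltgtP u v) uv => // lt _.
  have /andP[-> /eqP ->] := phi_mono i lt; by case: (dec i).
have /andP[ne /eqP e] := phi_mono i lt; rewrite eq_sym ne /=.
by move: e; case: (ltgtP (phi i v) (phi i u)) ne => //= _ _; case: (dec i).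
Qed.

(* y is the current point of the orbit and z that of the reference point x0
   along the same word: once [narrow] holds, it holds forever, and the
   comparison of y with a breakpoint that meets z only depends on d <= d0. *)
Definition narrow d0 d y z :=
  [|| `|y - z| < `|d - d0|, y == z | (y - z == d - d0) && (d < d0)].

(** Positions contract while [d - d0] stays fixed, so the third alternative, an equality with
    [d < d0], becomes the strict first one. *)
Lemma narrow_phi d0 d y z i : narrow d0 d y z -> narrow d0 d (phi i y) (phi i z).
Proof.
have lip := phi_lip i y z; rewrite /narrow => /or3P[h|/eqP ->|/andP[/eqP h dd]].
- apply/orP; left; apply: le_lt_trans lip (le_lt_trans _ h).
  by rewrite ler_piMl// ltW.
- by rewrite eqxx orbT.
- apply/orP; left; apply: le_lt_trans lip _; rewrite h.
  have : 0 < `|d - d0| by rewrite normr_gt0 subr_eq0 lt_eqF.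
  by move=> ?; rewrite gtr_pMl.
Qed.

(** The larger displacement decides the sign. The tie [y - z = d - d0] makes the bit true, so for
    [y != z] it counts as narrow only when [d < d0]. *)
Lemma narrow_bit d0 d y z : narrow d0 d y z -> (d - d0 <= y - z) = (d <= d0).
Proof.
rewrite /narrow => /or3P[h|/eqP ->|/andP[/eqP -> dd]].
- apply/idP/idP; move: h; rewrite ltr_norml; case: (ger0P (d - d0)); lra.
- by rewrite subrr subr_le0.
- by rewrite lexx ltW.
Qed.

Lemma wide_bit d0 d y z : ~~ narrow d0 d y z -> (d - d0 <= y - z) = (z < y).
Proof.
rewrite /narrow !negb_or -leNgt => /and3P[h yz].
rewrite negb_and -leNgt => h2; apply/idP/idP.
  case: (ltgtP y z) yz h h2 => // lt _.
  rewrite (ltr0_norm (_ : y - z < 0)) ?subr_lt0// => h h2 h3.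
  move: h h2; case: (ger0P (d - d0)) => dd h h2; first lra.
  have e : y - z = d - d0 by lra.
  by move: h2; rewrite e eqxx /= leNgt -subr_lt0 dd.
move=> lt; move: h; rewrite (gtr0_norm (_ : 0 < y - z)) ?subr_gt0//.
by move=> /(le_trans (ler_norm _)).
Qed.

(** * Words realised near one pair [(x0, d0)] *)

Section LocalCount.
Variables (x0 d0 : R).

(* The word of length t that starts near (x0, d0), given the time tau at which
   it becomes narrow, e1 = [d <= d0] and e2 = [x0 < x]. *)
Fixpoint local_word (tau : nat) (e1 e2 : bool) (t : nat) : seq 'I_k :=
  if t is t'.+1 then
    let w := local_word tau e1 e2 t' in
    let e := if (t' < tau)%N then e2 (+) reverses w else e1 in
    rcons w (piece_of i0 (fun j =>
      (a j + d0 < wcomp w x0) || (a j + d0 == wcomp w x0) && e))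
  else [::].

(** A breakpoint that misses the reference point [z t] keeps its side under small perturbations. One
    that meets it compares [d - d0] with [y t - z t]: before time [tau] the order of [x0] and [x]
    and the reversals decide, from then on the order of [d] and [d0]. So [tau] and two bits
    determine the word. *)
Lemma local_words (N : nat) : exists2 r, 0 < r &
  exists2 L : seq (seq 'I_k), (size L <= 4 * N.+1)%N &
  forall x d, `|x - x0| < r -> `|d - d0| < r -> itin d N x \in L.
Proof.
(* The gap ranges over all candidate words, so that the radius is chosen before [x] and [d]. *)
pose g (p : 'I_N.+1 * bool * bool * 'I_N.+1 * 'I_k.-1) :=
  a p.2 + d0 - wcomp (local_word p.1.1.1.1 p.1.1.1.2 p.1.1.2 p.1.2) x0.
have [r r0 rP] := finite_gap g.
exists (r / 2); first lra.
pose bits := [seq (e1, e2) | e1 <- [:: true; false], e2 <- [:: true; false]].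
exists [seq local_word p.1 p.2.1 p.2.2 N | p <-
   [seq (tau, e) | tau <- iota 0 N.+1, e <- bits]].
  by rewrite size_map size_allpairs size_iota /= mulnC.
move=> x d xr dr.
pose y t := iter t (f d) x; pose z t := wcomp (itin d t x) x0.
have yE t : y t = wcomp (itin d t x) x.
  by rewrite wcomp_itinerary//; exact: Omega_translate.
have narrowS t : narrow d0 d (y t) (z t) -> narrow d0 d (y t.+1) (z t.+1).
  by rewrite !yE /z itineraryS !wcomp_rcons; exact: narrow_phi.
have [tau tauN tauP] := nondecreasing_predE N narrowS.
have word_eq t : (t <= N)%N -> itin d t x = local_word tau (d <= d0) (x0 < x) t.
  elim: t => [//|t IH] tN; have {}IH := IH (ltnW tN).
  rewrite itineraryS /= -IH; congr rcons; apply: eq_piece_of => j.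
  rewrite -/(z t) -/(y t) /translate_param.
  have -> : (if (t < tau)%N then (x0 < x) (+) reverses (itin d t x) else d <= d0)
      = (d - d0 <= y t - z t).
    have := tauP t tN; case: ltnP => _ /= nar.
      (* Equal starting points would give [y t = z t], which is narrow. *)
      have xx0 : x0 != x.
        by apply: contraFN nar => /eqP e; rewrite yE /z e /narrow eqxx orbT.
      rewrite (wide_bit (negbT nar)) yE /z.
      by have /andP[_ /eqP ->] := wcomp_mono (itin d t x) xx0.
    by rewrite narrow_bit.
  (* Position and parameter each move by less than [r / 2], too little to cross a gap of [r]. *)
  have yz : `|y t - z t| < r / 2.
    rewrite yE /z; apply: le_lt_trans (wcomp_lip _ _ _) _.
    apply: le_lt_trans xr; rewrite ler_piMl// exprn_ile1// ltW//.
  have [e|ne] := eqVneq (a j + d0) (z t).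
    by rewrite e ltxx /=; apply/idP/idP; lra.
  have gap : r <= `|a j + d0 - z t|.
    pose p : 'I_N.+1 * bool * bool * 'I_N.+1 * 'I_k.-1 :=
      (Ordinal (tauN : tau < N.+1)%N, d <= d0, x0 < x,
       Ordinal (ltnW tN : t < N.+1)%N, j).
    have := rP p; rewrite /g /p /= -IH; apply; by rewrite subr_eq0.
  rewrite orbF; move: gap yz dr.
  rewrite !ltr_norml => gap /andP[h1 h2] /andP[h3 h4].
  by move: gap; case: (ger0P (a j + d0 - z t)) => h0 h; apply/idP/idP; lra.
rewrite (word_eq N (leqnn _)); apply/mapP; exists (tau, (d <= d0, x0 < x)) => //.
apply: allpairs_f; first by rewrite mem_iota.
by apply: allpairs_f; rewrite !inE; case: (d <= d0); case: (x0 < x).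
Qed.

End LocalCount.

(** * The absorbing interval and the growth of the number of words *)

Variable M : R.
Hypothesis M0 : 0 < M.
Hypothesis phi0M : forall i, `|phi i 0| + 1 <= (1 - q) * M.

(** The summand 1 is a margin: outside [[-M, M]] each step lowers the absolute value by at least 1,
    so every orbit enters. *)
Lemma norm_phi i x : `|phi i x| + 1 <= q * `|x| + (1 - q) * M.
Proof.
have := phi_lip i x 0; have := phi0M i; rewrite subr0.
have := lerB_dist (phi i x) (phi i 0); lra.
Qed.

Lemma wcomp_le w x : `|x| <= M -> `|wcomp w x| <= M.
Proof.
move=> xM; elim/last_ind: w => [//|w i IH]; rewrite wcomp_rcons.
have := norm_phi i (wcomp w x).
have : q * `|wcomp w x| <= q * M by rewrite ler_pM2l.
lra.
Qed.

Lemma iter_le d n x : `|x| <= M -> `|iter n (f d) x| <= M.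
Proof.
move=> xM; rewrite -(wcomp_itinerary phi i0); last exact: Omega_translate.
exact: wcomp_le.
Qed.

Lemma orbit_enters d x : exists n, `|iter n (f d) x| <= M.
Proof.
have [m] : exists m : nat, `|x| <= M + m%:R.
  exists (Num.truncn `|x|).+1; have := truncnS_gt `|x|; move: M0; lra.
elim: m x => [|m IH] x xm; first by exists 0%N; rewrite addr0 in xm.
have [xM|xM] := leP `|x| M; first by exists 0%N.
have [|n nM] := IH (f d x); last by exists n.+1; rewrite iterSr.
rewrite (pw_map_piece phi i0)//; last exact: Omega_translate.
have := norm_phi (piece i0 (translate_param a d) x) x.
have : (1 - q) * M <= (1 - q) * `|x| by rewrite ler_pM2l ?subr_gt0// ltW.
move: xm; rewrite -natr1; lra.
Qed.

Lemma uniform_local_words (N : nat) (B : R) : exists2 e, 0 < e &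
  forall x0 d0, `|x0| <= M -> `|d0| <= B ->
  exists2 L : seq (seq 'I_k), (size L <= 4 * N.+1)%N &
  forall x d, `|x - x0| < e -> `|d - d0| < e -> itin d N x \in L.
Proof.
pose K : set (R * R) := `[- M, M]%classic `*` `[- B, B]%classic.
have /compact_near_coveringP Kcov : compact K.
  by apply: compact_setX; exact: segment_compact.
pose P (e : R) (p : R * R) := exists2 L : seq (seq 'I_k), (size L <= 4 * N.+1)%N &
  forall x d, `|x - p.1| < e -> `|d - p.2| < e -> itin d N x \in L.
have : \forall e \near 0^'+, K `<=` P e.
  apply: Kcov => -[x0 d0] _; have [r r0 [L sL LP]] := local_words x0 d0 N.
  (* Half the radius is for the displacement of the centre, half for the distance to it. *)
  exists (ball (x0, d0) (r / 2), [set e | e < r / 2]).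
    split; first by apply: nbhsx_ballx; rewrite divr_gt0.
    by apply: nbhs_right_lt; rewrite divr_gt0.
  move=> -[[x1 d1] e] [[/= b1 b2] er]; exists L => //= x d xe de.
  move: b1 b2; rewrite /ball /= => b1 b2.
  apply: LP.
    rewrite -(subrKA x1); apply: le_lt_trans (ler_normD _ _) _.
    by rewrite distrC in b1; lra.
  rewrite -(subrKA d1); apply: le_lt_trans (ler_normD _ _) _.
  by rewrite distrC in b2; lra.
move=> KP; have : \forall e \near 0^'+, 0 < e /\ K `<=` P e.
  by near=> e; split; near: e; [exact: nbhs_right_gt|].
move=> /filter_ex[e [e0 KPe]]; exists e => // x0 d0 xM dB.
by apply: (KPe (x0, d0)); split; rewrite /= in_itv /= -ler_norml.
Unshelve. all: by end_near. Qed.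

(** Once a word [w] has [n0] letters or more, the orbit lies within [e] of [wcomp w 0], a point that
    depends on [w] alone; so [w] has at most [4 * N.+1] continuations by [N] letters. [K0] counts
    all words of length [n0]. *)
Lemma word_growth (N : nat) (B : R) : exists2 e, 0 < e & exists n0 K0 : nat,
  forall c m, `|c| <= B ->
  exists2 L : seq (seq 'I_k), (size L <= K0 * (4 * N.+1) ^ m)%N &
  forall x d, `|x| <= M -> `|d - c| < e -> itin d (n0 + m * N) x \in L.
Proof.
have [e e0 eP] := uniform_local_words N B; exists e => //.
have [n0 n0P] : exists n0, q ^+ n0 * M < e.
  by have [n nP] := geometric_small M q01 e0; exists n; exact: nP.
exists n0, (size [seq val w | w : n0.-tuple 'I_k]) => c m cB.
have /choice[U UP] (w : seq 'I_k) : exists U : seq (seq 'I_k),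
    (size U <= 4 * N.+1)%N /\
    forall x d, `|x - wcomp w 0| < e -> `|d - c| < e -> itin d N x \in U.
  have [|U sU UP] := eP (wcomp w 0) c _ cB; last by exists U.
  by apply: wcomp_le; rewrite normr0 ltW.
elim: m => [|m [L sL LP]].
  exists [seq val w | w : n0.-tuple 'I_k]; first by rewrite expn0 muln1.
  move=> x d _ _; rewrite mul0n addn0; apply/mapP.
  have sz := size_itinerary phi i0 (translate_param a d) n0 x.
  by exists (Tuple (introT eqP sz)); rewrite ?mem_enum.
exists [seq w ++ u | w <- L, u <- U w].
  rewrite size_allpairs_dep expnSr mulnA.
  apply: leq_trans (leq_mul sL (leqnn _)) => {LP sL}.
  elim: L => //= w L IH; rewrite mulSn leq_add//; exact: (UP w).1.
move=> x d xM dc; rewrite mulSn (addnC N) addnA itineraryD.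
apply: allpairs_f_dep; first exact: LP.
apply: (UP _).2 => //.
rewrite -(wcomp_itinerary phi i0); last exact: Omega_translate.
apply: le_lt_trans (wcomp_lip _ _ _) _; rewrite subr0 size_itinerary.
apply: le_lt_trans n0P; apply: ler_pM => //; first by rewrite exprn_ge0// ltW.
by rewrite exprD ler_piMr ?exprn_ge0 ?exprn_ile1// ltW.
Qed.

(** * Asymptotic periodicity when no breakpoint is close *)

Section NoBreakpoint.
Variables (d : R) (n : nat).
Hypothesis no_breakpoint : forall x j, `|x| <= M ->
  q ^+ n * M < `|translate_param a d j - wcomp (itin d n x) 0|.
Local Notation b := (translate_param a d).
Local Notation fd := (pw_map phi b).

Lemma wcomp_itin_dist x y : `|y| <= M ->
  `|wcomp (itin d n x) y - wcomp (itin d n x) 0| <= q ^+ n * M.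
Proof.
move=> yM; apply: le_trans (wcomp_lip _ _ _) _; rewrite subr0 size_itinerary.
by rewrite ler_wpM2l// exprn_ge0// ltW.
Qed.

(** The image of [[-M, M]] along the word stays within [q ^+ n * M] of the image of 0, hence on one
    side of every breakpoint. *)
Lemma next_letter x y : `|x| <= M -> `|y| <= M ->
  piece i0 b (wcomp (itin d n x) y) = piece i0 b (iter n fd x).
Proof.
move=> xM yM; apply: eq_piece_of => j.
have := no_breakpoint j xM.
have := wcomp_itin_dist x yM; have := wcomp_itin_dist x xM.
rewrite (wcomp_itinerary phi i0); last exact: Omega_translate.
set c := wcomp _ 0; set y' := wcomp _ y; set x' := iter _ _ _; set r := _ * M.
rewrite !ler_norml => /andP[h1 h2] /andP[h3 h4].
by case: (ger0P (b j - c)) => h0 h; apply/idP/idP; lra.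
Qed.

Lemma itinerary_eq x y : `|x| <= M -> `|y| <= M ->
  itin d n x = itin d n y -> forall t, itin d t x = itin d t y.
Proof.
move=> xM yM e t.
(* The [n] extra letters provide a full window before each new letter. *)
suff {t} H t : itin d (t + n) x = itin d (t + n) y.
  have /eqP := H t; rewrite !itineraryD.
  by rewrite eqseq_cat ?size_itinerary// => /andP[/eqP].
elim: t => [//|t IH]; rewrite addSn !itineraryS -IH; congr rcons.
have word_t : itin d n (iter t fd x) = itin d n (iter t fd y).
  by move/eqP: IH; rewrite !itineraryD eqseq_cat ?size_itinerary// => /andP[_ /eqP].
rewrite addnC !iterD -(next_letter (iter_le d t xM) (iter_le d t yM)).
rewrite word_t wcomp_itinerary//; exact: Omega_translate.
Qed.

Lemma iter_contract x y t : itin d t x = itin d t y ->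
  `|iter t fd x - iter t fd y| <= q ^+ t * `|x - y|.
Proof.
move=> e; rewrite -!(wcomp_itinerary phi i0) ?e; try exact: Omega_translate.
by apply: le_trans (wcomp_lip _ _ _) _; rewrite size_itinerary.
Qed.

Lemma periodic_point_le x p : (0 < p)%N -> iter p fd x = x -> `|x| <= M.
Proof.
move=> p0 px; have [T xM] := orbit_enters d x.
(* [T] periods take at least [T] steps, so [x] recurs after its orbit has entered. *)
rewrite -(iter_period T px) -(@subnK T (T * p)) ?leq_pmulr// iterD.
exact: iter_le.
Qed.

(** Over the common period [p * p'] the distance is both preserved and contracted. *)
Lemma periodic_point_uniq x y p p' : (0 < p)%N -> iter p fd x = x ->
  (0 < p')%N -> iter p' fd y = y -> itin d n x = itin d n y -> x = y.
Proof.
move=> p0 px p'0 py e.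
have xM := periodic_point_le p0 px; have yM := periodic_point_le p'0 py.
have := iter_contract (itinerary_eq xM yM e (p * p')).
rewrite (iter_period p py) mulnC (iter_period p' px) => h.
apply/eqP; rewrite -subr_eq0 -normr_le0 leNgt; apply/negP => xy.
move: h; rewrite ler_pMl// leNgt exprn_ilt1 ?ltW//.
by rewrite -lt0n muln_gt0 p0 p'0.
Qed.

Lemma finite_periodic_orbits : finite_set [set O | periodic_orbit fd O].
Proof.
pose per x := exists2 p, (0 < p)%N & iter p fd x = x.
have /choice[pt ptP] (w : n.-tuple 'I_k) : exists y, forall x, per x ->
    itin d n x = w -> y = x.
  have [[x [[p p0 px] xw]]|nx] := pselect (exists x, per x /\ itin d n x = w).
    exists x => y [p' p'0 py] yw.
    by apply: (periodic_point_uniq p0 px p'0 py); rewrite xw.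
  by exists 0 => x perx xw; case: nx; exists x.
have sub : [set O | periodic_orbit fd O] `<=`
    [set forward_orbit fd (pt w) | w in setT].
  move=> O [x [perx ->]].
  exists (Tuple (introT eqP (size_itinerary phi i0 b n x))) => //.
  by congr forward_orbit; exact: ptP.
apply: sub_finite_set sub _; exact/finite_image/finite_finset.
Qed.

Lemma wcomp_fixpoint w : exists2 z, `|z| <= M & wcomp w z = z.
Proof.
have wle x : `|x| <= M -> - M <= wcomp w x <= M.
  by rewrite -ler_norml; exact: wcomp_le.
have cts : continuous (fun x => x - wcomp w x).
  move=> x; apply: cvgB; first exact: cvg_id.
  apply: (lipschitz_cts (q := q ^+ size w)); first exact: exprn_gt0.
  exact: wcomp_lip.
have [||z] :=
  @IVT _ (fun x => x - wcomp w x) (- M) M 0 _ (continuous_subspaceT cts).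
- by move: M0; lra.
- have /wle/andP[h1 _] : `|- M| <= M by rewrite normrN gtr0_norm.
  have /wle/andP[_ h2] : `|M| <= M by rewrite gtr0_norm.
  by rewrite ge_min le_max; apply/andP; split; apply/orP; [left|right]; lra.
rewrite in_itv /= -ler_norml => zM /eqP; rewrite subr_eq0 => /eqP zw.
by exists z.
Qed.

Lemma recurrent_word x : exists s p, (0 < p)%N /\
  itin d n (iter s fd x) = itin d n (iter (p + s) fd x).
Proof.
pose g (s : 'I_(#|{: n.-tuple 'I_k}|.+1)) : n.-tuple 'I_k :=
  Tuple (introT eqP (size_itinerary phi i0 b n (iter s fd x))).
have /injectivePn[s [s' ss' /(congr1 val) /= gs]] : ~~ injectiveb g.
  apply/negP => /injectiveP /leq_card; by rewrite card_ord ltnn.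
wlog lt_s : s s' ss' gs / (s < s')%N.
  move=> H; case: (ltngtP s s') => [lt|lt|/val_inj e]; last by rewrite e eqxx in ss'.
    exact: H ss' gs lt.
  by apply: (H s' s) => //; rewrite eq_sym.
by exists s, (s' - s)%N; rewrite subn_gt0 lt_s subnK// ltnW.
Qed.

(** A repeated window makes the itinerary of [X] periodic. The fixed point [z] of its first [p]
    letters, pushed along the same word, follows a true orbit, which that of [x] approaches. *)
Lemma omega_limit_periodic x : periodic_orbit fd (omega_limit fd x).
Proof.
have Ob : Omega b by exact: Omega_translate.
have [T0 xM] := orbit_enters d x.
have [s [p [p0]]] := recurrent_word (iter T0 fd x).
rewrite iterD; set X := iter s fd _ => wordX.
have XM : `|X| <= M by exact: iter_le.
have itX := itinerary_eq XM (iter_le d p XM) wordX.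
have [z zM zE] := wcomp_fixpoint (itin d p X).
pose Z t := wcomp (itin d t X) z.
have ZM t : `|Z t| <= M by exact: wcomp_le.
have Zp m t : Z (m * p + t)%N = Z t.
  elim: m => [//|m IH]; rewrite mulSn -addnA -IH /Z itineraryD.
  by rewrite {1}/wcomp foldl_cat -/(wcomp _ _) -/(wcomp _ _) zE -itX.
have pieceX t : piece i0 b (iter (p + t) fd X) = piece i0 b (iter t fd X).
  have := itX t.+1; rewrite !itineraryS -iterD addnC => /eqP.
  by rewrite eqseq_rcons => /andP[_ /eqP ->].
have pieceXp m t : piece i0 b (iter (m * p + t) fd X) = piece i0 b (iter t fd X).
  by elim: m => [//|m IH]; rewrite mulSn -addnA pieceX.
have pieceZ t : piece i0 b (Z t) = piece i0 b (iter t fd X).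
  (* [next_letter] requires [n] earlier letters; a shift by [n] periods provides them, as [p] is
     positive. *)
  rewrite -(Zp n) -(pieceXp n).
  have -> : (n * p + t = (n * p + t - n) + n)%N by nia.
  set r := (_ - _)%N; rewrite /Z itineraryD {1}/wcomp foldl_cat.
  rewrite -/(wcomp _ _) -/(wcomp _ _) -/(Z r) (next_letter (iter_le d r XM) (ZM r)).
  by rewrite -iterD addnC.
have iterZ t : iter t fd z = Z t.
  elim: t => [//|t IH]; rewrite iterS IH (pw_map_piece phi i0)// pieceZ.
  by rewrite /Z itineraryS wcomp_rcons.
have pz : iter p fd z = z by rewrite iterZ /Z zE.
exists z; split; first by exists p.
apply: (omega_limit_shadow (q := q) (C := `|z - X|) (T := (s + T0)%N) q01 p0 pz).
move=> t; rewrite iterZ addnA iterD iterD -/X -(wcomp_itinerary phi i0)// /Z.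
apply: le_trans (wcomp_lip _ _ _) _; by rewrite size_itinerary.
Qed.

Lemma no_breakpoint_asymptotically_periodic : asymptotically_periodic fd.
Proof.
by split; [exact: finite_periodic_orbits|exact: omega_limit_periodic].
Qed.

End NoBreakpoint.

(** * Covers of the exceptional parameters *)

Lemma not_asymptotically_periodic_near d : ~ asymptotically_periodic (f d) ->
  forall n, exists x j, `|x| <= M /\
    `|translate_param a d j - wcomp (itin d n x) 0| <= q ^+ n * M.
Proof.
move=> nap n; apply: contrapT => H; apply: nap.
apply: (@no_breakpoint_asymptotically_periodic d n) => x j xM.
by rewrite ltNge; apply/negP => le; apply: H; exists x, j.
Qed.

(** A close breakpoint puts [d] near some [wcomp w 0 - a j]; the words [w] are counted separately
    around each point of a finite grid of mesh below [e]. *)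
Lemma not_asymptotically_periodic_cover (N : nat) : exists C : R, exists K : nat,
  0 < C /\ forall m, exists2 L : seq R, (size L <= K * (4 * N.+1) ^ m)%N &
  forall d, ~ asymptotically_periodic (f d) ->
    exists2 c, c \in L & `|d - c| <= C * (q ^+ N) ^+ m.
Proof.
pose B := M + \sum_j `|a j|.
have [e e0 [n0 [K0 growth]]] := word_growth N B.
have [E EP] := grid_cover B e0.
exists (q ^+ n0 * M), (size E * K0 * size (enum 'I_k.-1))%N.
split; first by rewrite mulr_gt0// exprn_gt0.
move=> m.
have /choice[W WP] (c : R) : exists W : seq (seq 'I_k),
    (size W <= K0 * (4 * N.+1) ^ m)%N /\ (`|c| <= B -> forall x d, `|x| <= M ->
      `|d - c| < e -> itin d (n0 + m * N) x \in W).
  have [cB|cB] := pselect (`|c| <= B); last by exists [::].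
  by have [W sW WP] := growth c m cB; exists W.
exists [seq wcomp p.1 0 - a p.2 | p <-
    [seq (w, j) | w <- flatten [seq W c | c <- E], j <- enum 'I_k.-1]].
  rewrite size_map size_allpairs mulnAC leq_mul// -mulnA size_flatten.
  elim: (E) => //= c E' IH; rewrite mulSn leq_add//; exact: (WP c).1.
move=> d nap.
(* The empty word already bounds [d]: some [a j + d] lies within [M] of 0. *)
have dB : `|d| <= B.
  have [x [j [_]]] := not_asymptotically_periodic_near nap 0.
  rewrite /= subr0 mul1r /translate_param => h.
  have : `|a j| <= \sum_j `|a j| by rewrite (bigD1 j)//= lerDl sumr_ge0.
  have := lerB_normD d (a j); rewrite addrC in h; rewrite /B; lra.
have [c cE [cB dc]] := EP d dB.
have [x [j [xM h]]] := not_asymptotically_periodic_near nap (n0 + m * N).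
exists (wcomp (itin d (n0 + m * N) x) 0 - a j).
  apply/mapP; exists (itin d (n0 + m * N) x, j) => //.
  apply: allpairs_f; last by rewrite mem_enum.
  by apply/flatten_mapP; exists c => //; exact: (WP c).2.
rewrite opprB addrA (addrC d) mulrAC -exprM -exprD (mulnC N m).
exact: h.
Qed.

Lemma hausdorff_dim_not_asymptotically_periodic :
  hausdorff_dim [set d | ~ asymptotically_periodic (f d)] = 0%E.
Proof.
apply: hausdorff_dim_eq0 => s d e s0 d0 e0.
have r01 : 0 < q `^ s < 1.
  rewrite powR_gt0//=; have -> : 1 = 1 `^ s :> R by rewrite powR1.
  by rewrite gt0_ltr_powR// ?nnegrE ltW.
(* The factor 4 in the word count turns 1/8 into 1/2, so the sum for the exponent [s] is at most [D]
   times (1/2)^m. *)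
have e80 : 0 < 8^-1 :> R by lra.
have [N N0 small] := linear_geometric_small r01 e80.
have [C [K [C0 cover]]] := not_asymptotically_periodic_cover N.
pose D := K%:R * (2 * C) `^ s.
have qN01 : 0 < q ^+ N < 1 by rewrite exprn_gt0// exprn_ilt1 ?ltW// -lt0n.
have half01 : 0 < (2^-1 : R) < 1 by lra.
have [m1 m1P] := geometric_small (2 * C) qN01 d0.
have [m2 m2P] := geometric_small D half01 e0.
pose m := maxn m1 m2.
have [L sL LP] := cover m; exists L, (C * (q ^+ N) ^+ m).
have qNm : 0 <= (q ^+ N) ^+ m by rewrite !exprn_ge0// ltW.
split.
- by rewrite mulr_ge0// ltW.
- by rewrite mulrA mulrC ltW// m1P// leq_maxl.
- apply: le_trans (ltW (m2P m (leq_maxr _ _))).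
  have C20 : 0 <= 2 * C by rewrite mulr_ge0// ltW.
  have -> : (2 * (C * (q ^+ N) ^+ m)) `^ s = (2 * C) `^ s * ((q `^ s) ^+ N) ^+ m.
    rewrite mulrA powRM// -!exprM; congr (_ * _).
    have qs0 : 0 <= q `^ s by exact: powR_ge0.
    by rewrite -powR_mulrn ?ltW// -powRrM mulrC powRrM powR_mulrn.
  apply: (@le_trans _ _ ((K * (4 * N.+1) ^ m)%:R *
      ((2 * C) `^ s * ((q `^ s) ^+ N) ^+ m))).
    by rewrite ler_wpM2r ?ler_nat// mulr_ge0 ?powR_ge0// !exprn_ge0// powR_ge0.
  rewrite natrM natrX mulrACA -exprMn mulrC -/D ler_wpM2r//.
    by rewrite mulr_ge0 ?powR_ge0.
  rewrite lerXn2r ?nnegrE// natrM -?mulrA; last lra.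
  by rewrite !mulr_ge0// exprn_ge0// powR_ge0.
- exact: LP.
Qed.

End PiecewiseContractions.

(** * Monotone branches and the choice of constants *)

Lemma injective_lipschitz_mono (R : realType) (q : R) (g : R -> R) : 0 < q ->
  (forall x y, `|g x - g y| <= q * `|x - y|) -> injective g ->
  exists dec : bool, forall x y, x < y -> (g x != g y) && ((g x < g y) == ~~ dec).
Proof.
move=> q0 glip ginj.
have cts : {within [set` `]-oo, +oo[%R], continuous g}.
  by apply: continuous_subspaceT; exact: lipschitz_cts glip.
have [|inc|decr] := @itv_continuous_inj_mono R g `]-oo, +oo[ cts.
- by move=> x y _ _; exact: ginj.
- exists false => x y /inc gxy; have {}gxy := gxy isT isT.
  by rewrite gxy lt_eqF.
- exists true => x y /decr gxy; have {}gxy := gxy isT isT.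
  by rewrite ltNge ltW// gt_eqF.
Qed.

Theorem theoremB (R : realType) (k : nat) (hk : (2 <= k)%N)
    (phi : 'I_k -> R -> R) (hphi : injective_IFS phi)
    (a : 'I_k.-1 -> R) (ha : Omega a) :
  hausdorff_dim [set delta : R |
    ~ asymptotically_periodic (pw_map phi (translate_param a delta))] = 0%E.
Proof.
case: hphi => ifs inj.
have i0 : 'I_k by exact: (Ordinal (ltnW hk)).
have /choice[Q QP] := ifs.
(* Starting the maximum at 1/2 makes the common rate positive. *)
pose q := \big[Num.max/2^-1]_i Q i.
have qi i : Q i <= q by exact: le_bigmax.
have q01 : 0 < q < 1.
  apply/andP; split.
    by apply: (@lt_le_trans _ _ 2^-1); [lra|exact: bigmax_ge_id].
  apply/bigmax_ltP; split; first lra.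
  by move=> i _; case: (QP i) => /andP[].
have lip i x y : `|phi i x - phi i y| <= q * `|x - y|.
  have [_ /(_ (x, y))] := QP i; move=> /(_ (conj I I)) /= h.
  by apply: le_trans h _; rewrite ler_wpM2r.
have q0 : 0 < q by case/andP: q01.
have /choice[dec mono] i := injective_lipschitz_mono q0 (lip i) (inj i).
pose m := \big[Num.max/0]_i `|phi i 0|.
have m0 : 0 <= m by exact: bigmax_ge_id.
have q1 : 0 < 1 - q by rewrite subr_gt0; case/andP: q01.
(* This [M] solves [(1 - q) * M = m + 1], where [m] bounds every value at 0. *)
apply: (hausdorff_dim_not_asymptotically_periodic i0 q01 lip mono ha
  (M := (m + 1) / (1 - q))).
  by rewrite divr_gt0// ltr_wpDl.
move=> i; rewrite mulrC divfK ?gt_eqF// lerD2r; exact: le_bigmax.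
Qed.
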